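(* Let $d$ be a positive rational number such that $\sqrt d\notin\mathbb{Q}$. There exist constants $\eta_d>0$, $\kappa_d>0$ and $N_d$, depending only on $d$, such that for every convergent $\alpha/\beta$ (with $\alpha,\beta$ positive coprime integers) of the continued fraction expansion of $\sqrt d$ with $\alpha,\beta\ge N_d$, we have $$\left|\sqrt d-\frac{n}{\alpha^m}\right|\ge\frac{1}{(\eta_d\alpha)^m}\quad\text{and}\quad\left|\sqrt d-\frac{n}{\beta^m}\right|\ge\frac{1}{(\kappa_d\beta)^m}$$ for every $n\in\mathbb{Z}$ and every integer $m$ sufficiently large in terms of $d,\alpha,\beta$. *)

(* Defs.v *)
From Stdlib Require Import Reals ZArith QArith Qreals.
Open Scope R_scope.

Definition Rfloor (x : R) : Z := Int_part x.

Fixpoint cf_rem (x : R) (k : nat) : R :=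
  match k with
  | O => x
  | S k' => / (cf_rem x k' - IZR (Rfloor (cf_rem x k')))
  end.

Definition cf_a (x : R) (k : nat) : Z := Rfloor (cf_rem x k).

(* (p_k, q_k, p_{k-1}, q_{k-1}) with the standard recurrence
   p_k = a_k p_{k-1} + p_{k-2}, q_k = a_k q_{k-1} + q_{k-2},
   p_{-1} = 1, q_{-1} = 0, p_{-2} = 0, q_{-2} = 1. *)
Fixpoint cf_pq (x : R) (k : nat) : Z * Z * Z * Z :=
  match k with
  | O => (cf_a x 0, 1%Z, 1%Z, 0%Z)
  | S k' =>
      let '(p, q, p', q') := cf_pq x k' in
      ((cf_a x k * p + p')%Z, (cf_a x k * q + q')%Z, p, q)
  end.

Definition cf_p (x : R) (k : nat) : Z := let '(p, _, _, _) := cf_pq x k in p.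
Definition cf_q (x : R) (k : nat) : Z := let '(_, q, _, _) := cf_pq x k in q.

Definition is_convergent (x : R) (a b : Z) : Prop :=
  exists k : nat, cf_p x k = a /\ cf_q x k = b.

(* Main.v *)
(* A convergent alpha/beta of sqrt d satisfies |alpha^2 - d beta^2| <= 2 sqrt d + 1.
   Hence w = d beta^2 / alpha^2, or its inverse when the denominators are powers of
   beta, lies within K/y^2 of 1, where y = alpha or beta is the base of the powers, and
   sqrt d is a rational multiple of t = sqrt w.  The unbalanced Pade approximants
     P(w) - t Q(w) = E * int_t^1 (1 - s^2)^a (1 - w/s^2)^b ds,  deg P = b,  deg Q = a,
   have coefficients with denominator dividing 4^b and exponential size in b, and
   their remainder is O(1)^b y^(-2(a+b)).  Since a is much smaller than b, the
   denominator of P(w)/Q(w) is y^(2(b-a)) times a factor exponential in b with base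
   independent of y.  This shares almost all of its size with the denominator y^m of
   n/y^m, so when n/y^m differs from P/Q, the two are at least 1/(C y)^m apart.
   The approximants for (a, b) and (a+1, b) are distinct, hence one of them always
   applies.  Only values of a primitive of the integrand are needed: the mean value
   theorem replaces the estimates of the integral. *)

Require Import Defs.
From Stdlib Require Import Reals ZArith QArith Qreals Lra Lia.
Open Scope R_scope.

(** * Generalized binomial coefficients *)

Fixpoint gbinom (x : R) (j : nat) : R :=
  match j with
  | O => 1
  | S i => gbinom x i * (x - INR i) / INR (S i)
  end.

Lemma INR_S_neq0 (n : nat) : INR (S n) <> 0.
Proof. apply not_0_INR; lia. Qed.

Lemma gbinom_S (x : R) (j : nat) :
  gbinom x (S j) * INR (S j) = gbinom x j * (x - INR j).
Proof. pose proof (INR_S_neq0 j). cbn [gbinom]. field. assumption. Qed.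

Lemma gbinom_absorb (x : R) (j : nat) :
  gbinom (x + 1) (S j) * INR (S j) = (x + 1) * gbinom x j.
Proof.
  induction j as [|j IH].
  - simpl. lra.
  - rewrite gbinom_S.
    apply Rmult_eq_reg_r with (INR (S j)); [|apply INR_S_neq0].
    replace (gbinom (x + 1) (S j) * (x + 1 - INR (S j)) * INR (S j))
      with (gbinom (x + 1) (S j) * INR (S j) * (x + 1 - INR (S j))) by ring.
    rewrite IH, (Rmult_assoc (x + 1) (gbinom x (S j))), gbinom_S, S_INR. ring.
Qed.

Lemma gbinom_pascal (x : R) (j : nat) :
  gbinom (x + 1) (S j) = gbinom x (S j) + gbinom x j.
Proof.
  apply Rmult_eq_reg_r with (INR (S j)); [|apply INR_S_neq0].
  rewrite gbinom_absorb, (Rmult_plus_distr_r (gbinom x (S j))), gbinom_S, S_INR. ring.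
Qed.

Lemma gbinom_shift (x : R) (j : nat) :
  gbinom (x + 1) j * (x + 1 - INR j) = (x + 1) * gbinom x j.
Proof. rewrite <- gbinom_S. apply gbinom_absorb. Qed.

Lemma gbinom_INR_S (n : nat) : gbinom (INR n) (S n) = 0.
Proof. cbn [gbinom]. unfold Rdiv. rewrite Rminus_diag. ring. Qed.

Lemma gbinom_pos (x : R) (j : nat) : INR j - 1 < x -> 0 < gbinom x j.
Proof.
  induction j as [|j IH]; intros Hx; [simpl; lra|].
  rewrite S_INR in Hx.
  cbn [gbinom]. apply Rdiv_lt_0_compat; [|apply lt_0_INR; lia].
  apply Rmult_lt_0_compat; [apply IH|]; lra.
Qed.

(** * Integrality and size of binomial coefficients at half-integers *)

Definition is_int (x : R) : Prop := exists z : Z, x = IZR z.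

Lemma is_int_IZR (z : Z) : is_int (IZR z).
Proof. now exists z. Qed.

Lemma is_int_plus (x y : R) : is_int x -> is_int y -> is_int (x + y).
Proof. intros [u ->] [v ->]. exists (u + v)%Z. now rewrite plus_IZR. Qed.

Lemma is_int_mult (x y : R) : is_int x -> is_int y -> is_int (x * y).
Proof. intros [u ->] [v ->]. exists (u * v)%Z. now rewrite mult_IZR. Qed.

Lemma is_int_pow (x : R) (n : nat) : is_int x -> is_int (x ^ n).
Proof.
  intros Hx. induction n as [|n IH]; simpl.
  - apply is_int_IZR.
  - now apply is_int_mult.
Qed.

Lemma is_int_sum (f : nat -> R) (n : nat) :
  (forall i, (i <= n)%nat -> is_int (f i)) -> is_int (sum_f_R0 f n).
Proof.
  induction n as [|n IH]; intros Hf; simpl.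
  - now apply Hf.
  - apply is_int_plus; [apply IH; intros; apply Hf|apply Hf]; lia.
Qed.

Lemma is_int_abs_ge1 (x : R) : is_int x -> x <> 0 -> 1 <= Rabs x.
Proof.
  intros [z ->] Hz. rewrite <- abs_IZR. apply IZR_le.
  assert (z <> 0%Z) by (intros ->; now apply Hz). lia.
Qed.

Lemma gbinom_INR_int (n j : nat) : is_int (gbinom (INR n) j).
Proof.
  revert j. induction n as [|n IH]; intros [|j]; try (exact (is_int_IZR 1)).
  - exists 0%Z. induction j as [|j IH].
    + simpl. lra.
    + cbn [gbinom] in *. rewrite IH. unfold Rdiv. ring.
  - rewrite S_INR, gbinom_pascal. now apply is_int_plus.
Qed.

(** Both sides have the ratio -2(2j+1)/(j+1) between consecutive terms. This link to the central
    binomial coefficient is the source of the powers of 4 in the denominators. *)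
Lemma gbinom_neg_half (j : nat) :
  4 ^ j * gbinom (- / 2) j = (-1) ^ j * gbinom (INR (2 * j)) j.
Proof.
  induction j as [|j IH]; [simpl; lra|].
  pose proof (INR_S_neq0 j) as HS.
  apply Rmult_eq_reg_r with (INR (S j) * INR (S j));
    [|now apply Rmult_integral_contrapositive_currified].
  assert (E : INR (2 * S j) = INR (2 * j) + 1 + 1).
  { replace (2 * S j)%nat with (S (S (2 * j))) by lia. now rewrite !S_INR. }
  rewrite E.
  pose proof (gbinom_absorb (INR (2 * j) + 1) j) as H1.
  pose proof (gbinom_shift (INR (2 * j)) j) as H2.
  pose proof (gbinom_S (- / 2) j) as H3.
  rewrite mult_INR in *. change (INR 2) with 2 in *. rewrite S_INR in *.
  set (t := INR j) in *.
  replace (2 * t + 1 - t) with (t + 1) in H2 by ring.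
  replace (4 ^ S j * gbinom (- / 2) (S j) * ((t + 1) * (t + 1)))
    with (4 ^ S j * (gbinom (- / 2) (S j) * (t + 1)) * (t + 1)) by ring.
  replace ((-1) ^ S j * gbinom (2 * t + 1 + 1) (S j) * ((t + 1) * (t + 1)))
    with ((-1) ^ S j * (gbinom (2 * t + 1 + 1) (S j) * (t + 1)) * (t + 1)) by ring.
  rewrite H1, H3.
  replace ((-1) ^ S j * ((2 * t + 1 + 1) * gbinom (2 * t + 1) j) * (t + 1))
    with ((-1) ^ S j * (2 * t + 1 + 1) * (gbinom (2 * t + 1) j * (t + 1))) by ring.
  rewrite H2.
  transitivity (4 ^ j * gbinom (- / 2) j * (4 * (- / 2 - t) * (t + 1))); [simpl; ring|].
  rewrite IH. simpl. field.
Qed.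

(** The case [a = 0] is the central binomial coefficient; Pascal's rule then raises [a]. *)
Lemma gbinom_half_int (a j : nat) : is_int (4 ^ j * gbinom (INR a - / 2) j).
Proof.
  revert j. induction a as [|a IH]; intros j.
  - replace (INR 0 - / 2) with (- / 2) by (simpl; ring).
    rewrite gbinom_neg_half. apply is_int_mult; [apply is_int_pow, is_int_IZR|].
    apply gbinom_INR_int.
  - destruct j as [|j]; [exists 1%Z; simpl; ring|].
    rewrite S_INR. replace (INR a + 1 - / 2) with (INR a - / 2 + 1) by ring.
    rewrite gbinom_pascal.
    replace (4 ^ S j * (gbinom (INR a - / 2) (S j) + gbinom (INR a - / 2) j))
      with (4 ^ S j * gbinom (INR a - / 2) (S j) + 4 * (4 ^ j * gbinom (INR a - / 2) j))
      by (simpl; ring).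
    apply is_int_plus; [apply IH|]. apply is_int_mult; [apply is_int_IZR|apply IH].
Qed.

(** At -1/2 each factor (-1/2 - i)/(i + 1) has absolute value at most 1, and each use of Pascal's
    rule at most doubles the bound. *)
Lemma gbinom_half_bound (a j : nat) : Rabs (gbinom (INR a - / 2) j) <= 2 ^ a.
Proof.
  revert j. induction a as [|a IH]; intros j.
  - simpl. induction j as [|j IH]; [simpl; rewrite Rabs_R1; lra|].
    cbn [gbinom]. unfold Rdiv. rewrite Rmult_assoc, Rabs_mult.
    rewrite <- (Rmult_1_r 1). apply Rmult_le_compat; try apply Rabs_pos; [exact IH|].
    pose proof (pos_INR j) as Hj.
    rewrite Rabs_mult, Rabs_inv, S_INR, (Rabs_pos_eq (INR j + 1)) by lra.
    apply Rmult_le_reg_r with (INR j + 1); [lra|].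
    rewrite Rmult_assoc, Rinv_l by lra. rewrite Rabs_left; lra.
  - destruct j as [|j].
    + simpl gbinom. rewrite Rabs_R1. apply pow_R1_Rle. lra.
    + rewrite S_INR. replace (INR a + 1 - / 2) with (INR a - / 2 + 1) by ring.
      rewrite gbinom_pascal. eapply Rle_trans; [apply Rabs_triang|].
      pose proof (IH (S j)). pose proof (IH j). simpl pow. lra.
Qed.

(** * Binomial theorem and partial fractions *)

Lemma sum_gbinom_S (g : nat -> R) (a : nat) :
  sum_f_R0 (fun i => gbinom (INR (S a)) i * g i) (S a)
  = sum_f_R0 (fun i => gbinom (INR a) i * g i) a
    + sum_f_R0 (fun i => gbinom (INR a) i * g (S i)) a.
Proof.
  (* The length [n] is kept apart from [a] for the induction; at [n = a] the extra top term vanishes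
     because C(a, a+1) = 0. *)
  assert (H : forall n,
    sum_f_R0 (fun i => gbinom (INR (S a)) i * g i) (S n)
    = sum_f_R0 (fun i => gbinom (INR a) i * g i) (S n)
      + sum_f_R0 (fun i => gbinom (INR a) i * g (S i)) n).
  { induction n as [|n IH].
    - cbn [sum_f_R0]. rewrite S_INR, gbinom_pascal. simpl. ring.
    - rewrite (tech5 (fun i => gbinom (INR (S a)) i * g i)), IH.
      rewrite (tech5 (fun i => gbinom (INR a) i * g i) (S n)).
      rewrite (tech5 (fun i => gbinom (INR a) i * g (S i)) n).
      rewrite S_INR, gbinom_pascal. ring. }
  rewrite H, tech5, gbinom_INR_S. ring.
Qed.

Lemma gbinom_thm (z : R) (a : nat) :
  sum_f_R0 (fun i => gbinom (INR a) i * z ^ i) a = (1 + z) ^ a.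
Proof.
  induction a as [|a IH]; [simpl; ring|].
  rewrite sum_gbinom_S, IH.
  replace (sum_f_R0 (fun i => gbinom (INR a) i * z ^ S i) a)
    with (z * (1 + z) ^ a); [simpl; ring|].
  rewrite <- IH, scal_sum. apply sum_eq. intros i _. simpl. ring.
Qed.

(* Equals [a! / (x (x+1) ... (x+a))]. *)
Definition pfrac (a : nat) (x : R) : R :=
  sum_f_R0 (fun i => gbinom (INR a) i * ((-1) ^ i / (x + INR i))) a.

Lemma pfrac_S (a : nat) (x : R) : pfrac (S a) x = pfrac a x - pfrac a (x + 1).
Proof.
  unfold pfrac. rewrite sum_gbinom_S. unfold Rminus. f_equal.
  match goal with |- _ = - ?t => replace (- t) with (-1 * t) by ring end.
  rewrite scal_sum.
  apply sum_eq. intros i _. rewrite S_INR.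
  replace (x + (INR i + 1)) with (x + 1 + INR i) by ring. simpl. unfold Rdiv. ring.
Qed.

(** Immediate for the product form of [pfrac]; for the sum it follows by induction from the
    difference equation [pfrac_S]. *)
Lemma pfrac_shift (a : nat) (x : R) :
  (forall i : nat, x + INR i <> 0) ->
  x * pfrac a x = (x + INR a + 1) * pfrac a (x + 1).
Proof.
  revert x. induction a as [|a IH]; intros x Hx.
  - pose proof (Hx 0%nat) as H0. pose proof (Hx 1%nat) as H1.
    unfold pfrac. simpl in *. field. split; lra.
  - assert (Hx1 : forall i : nat, x + 1 + INR i <> 0).
    { intros i. pose proof (Hx (S i)) as H. rewrite S_INR in H. lra. }
    pose proof (IH x Hx) as H1. pose proof (IH (x + 1) Hx1) as H2.
    rewrite !pfrac_S, S_INR.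
    transitivity (x * pfrac a x - x * pfrac a (x + 1)); [ring|].
    rewrite H1.
    transitivity ((x + INR a + 2) * pfrac a (x + 1)
      - (x + 1 + INR a + 1) * pfrac a (x + 1 + 1)); [|ring].
    rewrite <- H2. ring.
Qed.

(** Identifies the sum with its product form, as C(x+a, a) = (x+1)...(x+a)/a!. It supplies the base
    cases of the two coefficient formulas for the approximants. *)
Lemma gbinom_pfrac (a : nat) (x : R) :
  (forall i : nat, x + INR i <> 0) ->
  gbinom (x + INR a) a * (x * pfrac a x) = 1.
Proof.
  intros Hx. induction a as [|a IH].
  - pose proof (Hx 0%nat) as H0. unfold pfrac. simpl in *. field. lra.
  - pose proof (pfrac_shift a x Hx) as H1.
    pose proof (gbinom_absorb (x + INR a) a) as H2.
    rewrite pfrac_S. rewrite S_INR in *. rewrite <- Rplus_assoc.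
    replace (x * (pfrac a x - pfrac a (x + 1)))
      with ((INR a + 1) * pfrac a (x + 1)); [|rewrite Rmult_minus_distr_l, H1; ring].
    rewrite <- Rmult_assoc, H2, Rmult_comm, <- Rmult_assoc.
    rewrite (Rmult_comm (pfrac a (x + 1))), <- H1. rewrite Rmult_comm. exact IH.
Qed.

Lemma half_integer_neq0 (z : Z) : IZR z + / 2 <> 0.
Proof.
  intros H. assert (E : IZR (2 * z + 1) = 0) by (rewrite plus_IZR, mult_IZR; lra).
  apply eq_IZR in E. lia.
Qed.

Lemma half_sub_neq0 (r i : nat) : / 2 - INR r + INR i <> 0.
Proof.
  rewrite !INR_IZR_INZ.
  replace (/ 2 - IZR (Z.of_nat r) + IZR (Z.of_nat i))
    with (IZR (Z.of_nat i - Z.of_nat r) + / 2) by (rewrite minus_IZR; ring).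
  apply half_integer_neq0.
Qed.

Lemma sum_swap (f : nat -> nat -> R) (a b : nat) :
  sum_f_R0 (fun i => sum_f_R0 (fun r => f i r) b) a
  = sum_f_R0 (fun r => sum_f_R0 (fun i => f i r) a) b.
Proof.
  induction a as [|a IH]; [reflexivity|].
  cbn [sum_f_R0]. rewrite IH, <- plus_sum. reflexivity.
Qed.

(** * Pade approximants of the square root at 1 *)

Definition padeP (a b : nat) (w : R) : R :=
  sum_f_R0 (fun r => gbinom (INR a + / 2) r * gbinom (INR b - / 2) (b - r) * w ^ r) b.

Definition padeQ (a b : nat) (w : R) : R :=
  sum_f_R0 (fun i => gbinom (INR a + / 2) (a - i) * gbinom (INR b - / 2) i * w ^ i) a.

(** The constant that turns the partial fraction coefficients of the primitive into products of two
    binomial coefficients, whose denominators are powers of 2. *)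
Definition padeE (a b : nat) : R := gbinom (INR a + / 2) a * gbinom (INR b - / 2) b.

(** Term-by-term primitive in [s] of (1 - s^2)^a (1 - w/s^2)^b. The exponents 2i + 1 - 2r are odd,
    so no logarithm appears; powers of [/ s] keep the exponents natural. *)
Definition pade_prim (a b : nat) (w s : R) : R :=
  sum_f_R0 (fun i => sum_f_R0 (fun r =>
    gbinom (INR a) i * (-1) ^ i * (gbinom (INR b) r * (- w) ^ r)
    * (s ^ S (2 * i) * (/ s) ^ (2 * r) / (2 * INR i + 1 - 2 * INR r))) b) a.

(** Coefficient of w^r in [padeE a b * pade_prim a b w 1]. From r to r + 1 both sides change by the
    same ratio, given by [pfrac_shift] and the recurrences of the binomials. *)
Lemma padeP_coef (a b r : nat) : (r <= b)%nat ->
  padeE a b * (gbinom (INR b) r * (-1) ^ r * (/ 2 * pfrac a (/ 2 - INR r)))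
  = gbinom (INR a + / 2) r * gbinom (INR b - / 2) (b - r).
Proof.
  induction r as [|r IH]; intros Hr.
  - pose proof (gbinom_pfrac a (/ 2)) as H.
    rewrite (Rplus_comm (/ 2)) in H.
    unfold padeE. rewrite Nat.sub_0_r. simpl INR. rewrite Rminus_0_r. simpl.
    replace (gbinom (INR a + / 2) a * gbinom (INR b - / 2) b
             * (1 * 1 * (/ 2 * pfrac a (/ 2))))
      with (gbinom (INR b - / 2) b
            * (gbinom (INR a + / 2) a * (/ 2 * pfrac a (/ 2)))) by ring.
    rewrite H; [ring|].
    intros i. pose proof (half_sub_neq0 0 i) as H0. simpl in H0. lra.
  - specialize (IH ltac:(lia)).
    pose proof (pfrac_shift a (/ 2 - INR (S r)) (half_sub_neq0 (S r))) as H1.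
    pose proof (gbinom_S (INR b) r) as H2.
    pose proof (gbinom_S (INR a + / 2) r) as H3.
    pose proof (gbinom_S (INR b - / 2) (b - S r)) as H4.
    replace (S (b - S r)) with (b - r)%nat in H4 by lia.
    rewrite !minus_INR in H4 by lia.
    pose proof (pos_INR r) as Hr0.
    rewrite S_INR in *.
    replace (/ 2 - (INR r + 1) + 1) with (/ 2 - INR r) in H1 by ring.
    (* The factor r + 1/2 is minus the 1/2 - (r + 1) of [pfrac_shift]; the sign cancels against the
       new factor -1. *)
    apply Rmult_eq_reg_r with ((INR r + 1) * (INR r + / 2)); [|nra].
    set (T := pfrac a (/ 2 - INR r)) in *.
    set (T' := pfrac a (/ 2 - (INR r + 1))) in *.
    set (g := gbinom (INR b) r) in *. set (g' := gbinom (INR b) (S r)) in *.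
    set (h := gbinom (INR a + / 2) r) in *. set (h' := gbinom (INR a + / 2) (S r)) in *.
    set (k := gbinom (INR b - / 2) (b - r)) in *.
    set (k' := gbinom (INR b - / 2) (b - S r)) in *.
    transitivity (padeE a b * ((g' * (INR r + 1)) * (-1) ^ r
      * (/ 2 * ((/ 2 - (INR r + 1)) * T')))); [simpl; field|].
    rewrite H1, H2.
    transitivity (padeE a b * (g * (-1) ^ r * (/ 2 * T))
      * ((INR b - INR r) * (INR a + / 2 - INR r))); [field|].
    rewrite IH.
    transitivity ((h * (INR a + / 2 - INR r)) * (k * (INR b - INR r))); [ring|].
    rewrite <- H3, H4. field.
Qed.

(** The same recursion with [a] and [b] exchanged: for w = s^2 the sum over r is a partial fraction
    of order [b]. *)
Lemma padeQ_coef (a b i : nat) : (i <= a)%nat ->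
  padeE a b * (gbinom (INR a) i * (-1) ^ i * (- / 2 * pfrac b (/ 2 - INR (S i))))
  = gbinom (INR a + / 2) (a - i) * gbinom (INR b - / 2) i.
Proof.
  induction i as [|i IH]; intros Hi.
  - pose proof (gbinom_pfrac b (- / 2)) as H.
    rewrite (Rplus_comm (- / 2)) in H.
    unfold padeE. rewrite Nat.sub_0_r. simpl.
    replace (/ 2 - 1) with (- / 2) by field.
    unfold Rminus.
    replace (gbinom (INR a + / 2) a * gbinom (INR b + - / 2) b
             * (1 * 1 * (- / 2 * pfrac b (- / 2))))
      with (gbinom (INR a + / 2) a
            * (gbinom (INR b + - / 2) b * (- / 2 * pfrac b (- / 2)))) by ring.
    rewrite H; [ring|].
    intros i. pose proof (half_sub_neq0 1 i) as H0. simpl in H0. lra.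
  - specialize (IH ltac:(lia)).
    pose proof (pfrac_shift b (/ 2 - INR (S (S i))) (half_sub_neq0 (S (S i)))) as H1.
    pose proof (gbinom_S (INR a) i) as H2.
    pose proof (gbinom_S (INR b - / 2) i) as H3.
    pose proof (gbinom_S (INR a + / 2) (a - S i)) as H4.
    replace (S (a - S i)) with (a - i)%nat in H4 by lia.
    rewrite !minus_INR in H4 by lia.
    pose proof (pos_INR i) as Hi0.
    rewrite !S_INR in *.
    replace (/ 2 - (INR i + 1 + 1) + 1) with (/ 2 - (INR i + 1)) in H1 by ring.
    apply Rmult_eq_reg_r with ((INR i + 1) * (INR i + 3 / 2)); [|nra].
    set (T := pfrac b (/ 2 - (INR i + 1))) in *.
    set (T' := pfrac b (/ 2 - (INR i + 1 + 1))) in *.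
    set (g := gbinom (INR a) i) in *. set (g' := gbinom (INR a) (S i)) in *.
    set (h := gbinom (INR b - / 2) i) in *. set (h' := gbinom (INR b - / 2) (S i)) in *.
    set (k := gbinom (INR a + / 2) (a - i)) in *.
    set (k' := gbinom (INR a + / 2) (a - S i)) in *.
    transitivity (padeE a b * ((g' * (INR i + 1)) * (-1) ^ i
      * (- / 2 * ((/ 2 - (INR i + 1 + 1)) * T')))); [simpl; field|].
    rewrite H1, H2.
    transitivity (padeE a b * (g * (-1) ^ i * (- / 2 * T))
      * ((INR a - INR i) * (INR b - / 2 - INR i))); [field|].
    rewrite IH.
    transitivity ((k * (INR a - INR i)) * (h * (INR b - / 2 - INR i))); [ring|].
    rewrite <- H3, H4. field.
Qed.

Lemma pow_opp (w : R) (r : nat) : (- w) ^ r = (-1) ^ r * w ^ r.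
Proof. rewrite <- Rpow_mult_distr. f_equal. ring. Qed.

Lemma two_half_neq0 (i r : nat) : 2 * INR i + 1 - 2 * INR r <> 0.
Proof. pose proof (half_sub_neq0 r i). lra. Qed.

Lemma pade_prim_at1 (a b : nat) (w : R) :
  padeE a b * pade_prim a b w 1 = padeP a b w.
Proof.
  unfold pade_prim, padeP. rewrite sum_swap, scal_sum.
  apply sum_eq. intros r Hr. rewrite <- padeP_coef by assumption.
  unfold pfrac.
  transitivity (padeE a b * (gbinom (INR b) r * (-1) ^ r * w ^ r * / 2
    * sum_f_R0 (fun i => gbinom (INR a) i * ((-1) ^ i / (/ 2 - INR r + INR i))) a)).
  2: ring.
  rewrite Rmult_comm. f_equal. rewrite scal_sum. apply sum_eq. intros i _.
  rewrite Rinv_1, !pow1, pow_opp.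
  pose proof (two_half_neq0 i r). pose proof (half_sub_neq0 r i).
  field. lra.
Qed.

(** Here (-w)^r s^(-2r) = (-1)^r, so only the odd powers s^(2i+1) remain; they produce the factor
    [s] in front of Q. *)
Lemma pade_prim_at_root (a b : nat) (s : R) : s <> 0 ->
  padeE a b * pade_prim a b (s ^ 2) s = s * padeQ a b (s ^ 2).
Proof.
  intros Hs. unfold pade_prim, padeQ. rewrite !scal_sum.
  apply sum_eq. intros i Hi. rewrite <- padeQ_coef by assumption.
  unfold pfrac.
  transitivity (padeE a b * (s * (gbinom (INR a) i * (-1) ^ i * (s ^ 2) ^ i * - / 2)
    * sum_f_R0 (fun r => gbinom (INR b) r * ((-1) ^ r / (/ 2 - INR (S i) + INR r))) b)).
  2: ring.
  rewrite Rmult_comm. f_equal. rewrite scal_sum. apply sum_eq. intros r _.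
  rewrite pow_opp.
  assert (E : (s ^ 2) ^ r * (/ s) ^ (2 * r) = 1).
  { rewrite pow_mult, <- Rpow_mult_distr. replace (s ^ 2 * (/ s) ^ 2) with 1 by now field.
    apply pow1. }
  pose proof (two_half_neq0 i r). pose proof (half_sub_neq0 (S i) r).
  rewrite S_INR in *. change (s ^ S (2 * i)) with (s * s ^ (2 * i)).
  rewrite <- (pow_mult s 2 i).
  transitivity (gbinom (INR a) i * (-1) ^ i * (gbinom (INR b) r * (-1) ^ r)
    * (s * s ^ (2 * i)) * ((s ^ 2) ^ r * (/ s) ^ (2 * r)) / (2 * INR i + 1 - 2 * INR r)).
  { field. assumption. }
  rewrite E. field. split; lra.
Qed.

Lemma pade_remainder (a b : nat) (s : R) : s <> 0 ->
  padeP a b (s ^ 2) - s * padeQ a b (s ^ 2)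
  = padeE a b * (pade_prim a b (s ^ 2) 1 - pade_prim a b (s ^ 2) s).
Proof.
  intros Hs. rewrite <- pade_prim_at1, <- pade_prim_at_root by assumption. ring.
Qed.

(** * Derivative of the primitive *)

Lemma derivable_pt_lim_monomial (n m : nat) (s : R) : s <> 0 ->
  derivable_pt_lim (fun t => t ^ n * (/ t) ^ m) s
    ((INR n - INR m) * (s ^ n * (/ s) ^ m * / s)).
Proof.
  intros Hs. induction n as [|n IHn].
  - induction m as [|m IHm].
    + apply derivable_pt_lim_ext with (fun _ => 1); [intros; simpl; ring|].
      replace ((INR 0 - INR 0) * (s ^ 0 * (/ s) ^ 0 * / s)) with 0 by (simpl; ring).
      apply derivable_pt_lim_const.
    + apply derivable_pt_lim_ext with (mult_fct (fun t => t ^ 0 * (/ t) ^ m) Rinv).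
      { intros t. unfold mult_fct. simpl. ring. }
      replace ((INR 0 - INR (S m)) * (s ^ 0 * (/ s) ^ S m * / s))
        with ((INR 0 - INR m) * (s ^ 0 * (/ s) ^ m * / s) * / s
              + (s ^ 0 * (/ s) ^ m) * (- / s ^ 2))
        by (rewrite S_INR; simpl; field; assumption).
      apply (derivable_pt_lim_mult (fun t => t ^ 0 * (/ t) ^ m) Rinv); [exact IHm|].
      apply derivable_pt_lim_ext with (div_fct (fct_cte 1) id).
      { intros t. unfold div_fct, fct_cte, id, Rdiv. ring. }
      replace (- / s ^ 2) with ((0 * id s - 1 * fct_cte 1 s) / Rsqr (id s))
        by (unfold Rsqr, id, fct_cte; field; assumption).
      apply derivable_pt_lim_div; [apply derivable_pt_lim_const
        |apply derivable_pt_lim_id|assumption].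
  - apply derivable_pt_lim_ext with (mult_fct (fun t => t ^ n * (/ t) ^ m) id).
    { intros t. unfold mult_fct, id. simpl. ring. }
    replace ((INR (S n) - INR m) * (s ^ S n * (/ s) ^ m * / s))
      with ((INR n - INR m) * (s ^ n * (/ s) ^ m * / s) * id s
            + (s ^ n * (/ s) ^ m) * 1)
      by (rewrite S_INR; unfold id; simpl; field; assumption).
    apply (derivable_pt_lim_mult (fun t => t ^ n * (/ t) ^ m) id); [exact IHn|apply derivable_pt_lim_id].
Qed.

Lemma derivable_pt_lim_sum (f : nat -> R -> R) (l : nat -> R) (n : nat) (s : R) :
  (forall i, (i <= n)%nat -> derivable_pt_lim (f i) s (l i)) ->
  derivable_pt_lim (fun t => sum_f_R0 (fun i => f i t) n) s (sum_f_R0 l n).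
Proof.
  induction n as [|n IH]; intros Hf; simpl.
  - now apply Hf.
  - apply derivable_pt_lim_plus; [apply IH; intros; apply Hf|apply Hf]; lia.
Qed.

(** The double sum of derivatives is the product of the binomial expansions in -s^2 and -w/s^2. *)
Lemma pade_prim_derive (a b : nat) (w s : R) : s <> 0 ->
  derivable_pt_lim (pade_prim a b w) s ((1 - s ^ 2) ^ a * (1 - w / s ^ 2) ^ b).
Proof.
  intros Hs.
  replace ((1 - s ^ 2) ^ a * (1 - w / s ^ 2) ^ b)
    with (sum_f_R0 (fun i => sum_f_R0 (fun r =>
      gbinom (INR a) i * (-1) ^ i * (gbinom (INR b) r * (- w) ^ r)
      * (s ^ (2 * i) * (/ s) ^ (2 * r))) b) a).
  - unfold pade_prim. apply derivable_pt_lim_sum. intros i _.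
    apply derivable_pt_lim_sum. intros r _.
    set (c := gbinom (INR a) i * (-1) ^ i * (gbinom (INR b) r * (- w) ^ r)).
    pose proof (two_half_neq0 i r) as Hir.
    apply derivable_pt_lim_ext with (mult_real_fct (c / (2 * INR i + 1 - 2 * INR r))
      (fun t => t ^ S (2 * i) * (/ t) ^ (2 * r))).
    { intros t. unfold mult_real_fct. field. assumption. }
    replace (c * (s ^ (2 * i) * (/ s) ^ (2 * r)))
      with (c / (2 * INR i + 1 - 2 * INR r) * ((INR (S (2 * i)) - INR (2 * r))
        * (s ^ S (2 * i) * (/ s) ^ (2 * r) * / s))).
    + apply derivable_pt_lim_scal. now apply derivable_pt_lim_monomial.
    + change (s ^ S (2 * i)) with (s * s ^ (2 * i)).
      rewrite S_INR, !mult_INR. change (INR 2) with 2. field. auto.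
  - replace (1 - s ^ 2) with (1 + - s ^ 2) by ring.
    replace (1 - w / s ^ 2) with (1 + - w * / s ^ 2) by (field; assumption).
    rewrite <- !gbinom_thm, Rmult_comm, scal_sum.
    apply sum_eq. intros i _. rewrite Rmult_comm, scal_sum.
    apply sum_eq. intros r _. rewrite (pow_opp (s ^ 2)), (Rpow_mult_distr (- w)).
    rewrite !pow_mult, !pow_inv.
    ring.
Qed.

Lemma INR_half_S (a : nat) : INR a + / 2 = INR (S a) - / 2.
Proof. rewrite S_INR. field. Qed.

(** * Denominators of the approximants at w = U/(V y^2) *)

Section PadeIntegrality.
Variables U V y : R.
Hypotheses (U_int : is_int U) (V_int : is_int V) (y_int : is_int y).
Hypotheses (V_neq0 : V <> 0) (y_neq0 : y <> 0).

Lemma pow_ratio_clear (i n : nat) : (i <= n)%nat ->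
  V ^ n * y ^ (2 * n) * (U / (V * y ^ 2)) ^ i = U ^ i * V ^ (n - i) * y ^ (2 * (n - i)).
Proof.
  intros Hi. replace n with (i + (n - i))%nat at 1 2 by lia.
  rewrite Nat.mul_add_distr_l, !pow_add.
  replace (V ^ i * V ^ (n - i) * (y ^ (2 * i) * y ^ (2 * (n - i)))
           * (U / (V * y ^ 2)) ^ i)
    with ((V ^ i * y ^ (2 * i) * (U / (V * y ^ 2)) ^ i)
          * (V ^ (n - i) * y ^ (2 * (n - i)))) by ring.
  rewrite pow_mult, <- !Rpow_mult_distr.
  replace (V * y ^ 2 * (U / (V * y ^ 2))) with U by (field; split; assumption).
  ring.
Qed.

(** In each term 4^b is shared between the two binomial coefficients as 4^r and 4^(b-r), while V^b
    y^(2b) clears w^r. *)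
Lemma padeP_int (a b : nat) :
  is_int (4 ^ b * V ^ b * y ^ (2 * b) * padeP a b (U / (V * y ^ 2))).
Proof.
  unfold padeP. rewrite scal_sum. apply is_int_sum. intros r Hr.
  rewrite INR_half_S.
  replace (4 ^ b) with (4 ^ r * 4 ^ (b - r)) by (rewrite <- pow_add; f_equal; lia).
  match goal with |- is_int (?g * ?h * ?z * (?c * ?d * ?e * ?f)) =>
    replace (g * h * z * (c * d * e * f)) with ((c * g) * (d * h) * (e * f * z)) by ring
  end.
  rewrite pow_ratio_clear by assumption.
  repeat (apply gbinom_half_int || (apply is_int_pow; assumption) || apply is_int_mult).
Qed.

(** As Q has degree only [a], the power y^(2a) suffices, which leaves room for the denominator y^m
    of the fraction compared with P/Q. The factors 4^b and V^b match those used for P. *)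
Lemma padeQ_int (a b : nat) : (a <= b)%nat ->
  is_int (4 ^ b * V ^ b * y ^ (2 * a) * padeQ a b (U / (V * y ^ 2))).
Proof.
  intros Hab. unfold padeQ. rewrite scal_sum. apply is_int_sum. intros i Hi.
  rewrite INR_half_S.
  replace (4 ^ b) with (4 ^ (b - a) * (4 ^ (a - i) * 4 ^ i))
    by (rewrite <- !pow_add; f_equal; lia).
  replace (V ^ b) with (V ^ (b - a) * V ^ a) by (rewrite <- pow_add; f_equal; lia).
  match goal with
    |- is_int (?g * ?h * ?z * (?c * (?d * ?d') * (?e * ?e') * ?f)) =>
    replace (g * h * z * (c * (d * d') * (e * e') * f))
      with (c * e * (d * g) * (d' * h) * (e' * f * z)) by ring
  end.
  rewrite pow_ratio_clear by assumption.
  repeat (apply gbinom_half_int || (apply is_int_pow; assumption || apply is_int_IZR)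
          || apply is_int_mult).
Qed.

End PadeIntegrality.

(** * Positivity and size of E and Q *)

Lemma gbinom_half_pos (n j : nat) : (j <= n)%nat -> 0 < gbinom (INR n - / 2) j.
Proof. intros H. apply gbinom_pos. apply le_INR in H. lra. Qed.

Lemma gbinom_half_le (n j : nat) : gbinom (INR n - / 2) j <= 2 ^ n.
Proof. eapply Rle_trans; [apply Rle_abs|apply gbinom_half_bound]. Qed.

Lemma padeE_pos (a b : nat) : 0 < padeE a b.
Proof.
  unfold padeE. rewrite INR_half_S.
  apply Rmult_lt_0_compat; apply gbinom_half_pos; lia.
Qed.

Lemma padeE_bound (a b : nat) : (a <= b)%nat -> padeE a b <= 2 * 4 ^ b.
Proof.
  intros Hab. unfold padeE. rewrite INR_half_S.
  apply Rle_trans with (2 ^ S a * 2 ^ b).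
  - apply Rmult_le_compat; try apply gbinom_half_le;
      left; apply gbinom_half_pos; lia.
  - replace 4 with (2 * 2) by ring. rewrite Rpow_mult_distr. simpl.
    assert (2 ^ a <= 2 ^ b) by (apply Rle_pow; [lra|assumption]).
    pose proof (pow_lt 2 b ltac:(lra)). nra.
Qed.

(** The exact ratio is (a + 3/2)/(a + 1). *)
Lemma padeE_S (a b : nat) : padeE (S a) b <= 3 / 2 * padeE a b.
Proof.
  pose proof (gbinom_absorb (INR a + / 2) a) as H.
  pose proof (gbinom_half_pos (S a) a ltac:(lia)) as H1.
  rewrite <- INR_half_S in H1.
  pose proof (gbinom_half_pos b b ltac:(lia)) as H2.
  unfold padeE. rewrite S_INR in *.
  replace (INR a + / 2 + 1) with (INR a + 1 + / 2) in H by ring.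
  pose proof (pos_INR a) as Ha.
  assert (H3 : gbinom (INR a + 1 + / 2) (S a) <= 3 / 2 * gbinom (INR a + / 2) a).
  { apply Rmult_le_reg_r with (INR a + 1); [lra|]. rewrite H. nra. }
  nra.
Qed.

Lemma sum_f_R0_pos (f : nat -> R) (n : nat) :
  (forall i, (i <= n)%nat -> 0 < f i) -> 0 < sum_f_R0 f n.
Proof.
  induction n as [|n IH]; intros Hf; simpl; [now apply Hf|].
  apply Rplus_lt_0_compat; [apply IH; intros; apply Hf|apply Hf]; lia.
Qed.

Lemma padeQ_pos (a b : nat) (w : R) : (a <= b)%nat -> 0 < w -> 0 < padeQ a b w.
Proof.
  intros Hab Hw. unfold padeQ. rewrite INR_half_S.
  apply sum_f_R0_pos. intros i Hi. repeat apply Rmult_lt_0_compat;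
    [apply gbinom_half_pos|apply gbinom_half_pos|apply pow_lt]; lia || assumption.
Qed.

(** There are a + 1 <= 2^a terms, each at most 2^(a+1) 2^b 2^a. *)
Lemma padeQ_bound (a b : nat) (w : R) : (a <= b)%nat -> 0 < w -> w <= 2 ->
  padeQ a b w <= 2 * 16 ^ b.
Proof.
  intros Hab Hw Hw2. unfold padeQ. rewrite INR_half_S.
  assert (Ha : 2 ^ a <= 2 ^ b) by (apply Rle_pow; [lra|assumption]).
  assert (H0 : 0 < 2 ^ a) by (apply pow_lt; lra).
  apply Rle_trans with (sum_f_R0 (fun _ => 2 ^ S a * 2 ^ b * 2 ^ a) a).
  - apply sum_Rle. intros i Hi.
    pose proof (gbinom_half_pos (S a) (a - i) ltac:(lia)).
    pose proof (gbinom_half_pos b i ltac:(lia)).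
    repeat apply Rmult_le_compat; try apply gbinom_half_le; try lra.
    + apply Rmult_le_pos; lra.
    + apply pow_le; lra.
    + apply Rle_trans with (2 ^ i); [apply pow_incr; lra|apply Rle_pow; [lra|lia]].
  - rewrite sum_cte.
    assert (HS : INR (S a) <= 2 ^ a).
    { clear. induction a as [|a IH]; [simpl; lra|].
      rewrite S_INR. simpl pow. pose proof (pow_R1_Rle 2 a ltac:(lra)). lra. }
    replace 16 with (2 * 2 * 2 * 2) by ring. rewrite !Rpow_mult_distr.
    pose proof (pos_INR (S a)).
    simpl (2 ^ S a).
    apply Rle_trans with (2 * 2 ^ b * 2 ^ b * 2 ^ b * 2 ^ b); [|right; ring].
    repeat apply Rmult_le_compat; try lra; repeat apply Rmult_le_pos; lra.
Qed.

(** By Pascal's rule each coefficient grows with [a], and the new top term is positive. *)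
Lemma padeQ_S (a b : nat) (w : R) : (S a <= b)%nat -> 0 < w ->
  padeQ a b w <= padeQ (S a) b w.
Proof.
  intros Hab Hw. unfold padeQ at 2. rewrite tech5.
  match goal with |- _ <= ?x + ?z => assert (0 < z) end.
  { rewrite INR_half_S. apply Rmult_lt_0_compat; [|now apply pow_lt].
    apply Rmult_lt_0_compat; apply gbinom_half_pos; lia. }
  match goal with |- ?u <= ?x + ?z => enough (u <= x) by lra end.
  unfold padeQ. apply sum_Rle. intros i Hi.
  apply Rmult_le_compat_r; [left; now apply pow_lt|].
  apply Rmult_le_compat_r; [left; apply gbinom_half_pos; lia|].
  replace (S a - i)%nat with (S (a - i)) by lia.
  rewrite S_INR. replace (INR a + 1 + / 2) with (INR a + / 2 + 1) by ring.
  rewrite gbinom_pascal, INR_half_S.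
  pose proof (gbinom_half_pos (S a) (S (a - i)) ltac:(lia)). lra.
Qed.

(** * Remainder estimate and independence of neighbouring approximants *)

Lemma mvt_one (f f' : R -> R) (t : R) : 0 < t -> t <> 1 ->
  (forall s, s <> 0 -> derivable_pt_lim f s (f' s)) ->
  exists s, f 1 - f t = f' s * (1 - t) /\ (t < s < 1 \/ 1 < s < t).
Proof.
  intros Ht Ht1 Hf.
  destruct (Rlt_le_dec t 1) as [H|H].
  - destruct (MVT_cor2 f f' t 1 H) as [s [Hs1 Hs2]]; [intros; apply Hf; lra|].
    exists s. auto.
  - destruct (MVT_cor2 f f' 1 t) as [s [Hs1 Hs2]]; [lra|intros; apply Hf; lra|].
    exists s. split; [lra|auto].
Qed.

(** As s^2 lies between t^2 and 1, the quotient (s^2 - t^2)/s^2 loses at most the factor 1/s^2 <= 2.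
    Strict positivity keeps the integrand nonzero, as the independence argument requires. *)
Lemma between_factors (t s : R) : 0 < t -> Rabs (1 - t ^ 2) <= / 2 ->
  t < s < 1 \/ 1 < s < t ->
  0 < Rabs (1 - s ^ 2) <= Rabs (1 - t ^ 2)
  /\ 0 < Rabs (1 - t ^ 2 / s ^ 2) <= 2 * Rabs (1 - t ^ 2).
Proof.
  intros Ht Hd Hs.
  assert (Hs0 : 0 < s) by lra.
  assert (Hs2 : 0 < s ^ 2) by (apply pow_lt; lra).
  assert (E : 1 - t ^ 2 / s ^ 2 = (s ^ 2 - t ^ 2) * / s ^ 2) by (field; lra).
  assert (Hi : 0 < / s ^ 2) by (apply Rinv_0_lt_compat; assumption).
  assert (Hm : s ^ 2 * / s ^ 2 = 1) by (apply Rinv_r; lra).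
  destruct Hs as [Hs|Hs].
  - assert (H1 : t ^ 2 < s ^ 2) by (simpl; nra).
    assert (H2 : s ^ 2 < 1) by (simpl; nra).
    rewrite (Rabs_pos_eq (1 - t ^ 2)) in * by lra.
    rewrite E, Rabs_mult, (Rabs_pos_eq (1 - s ^ 2)), (Rabs_pos_eq (s ^ 2 - t ^ 2)),
      (Rabs_pos_eq (/ s ^ 2)) by lra.
    assert (/ s ^ 2 <= 2) by (apply Rmult_le_reg_l with (s ^ 2); lra).
    repeat split; try lra; try nra.
  - assert (H1 : s ^ 2 < t ^ 2) by (simpl; nra).
    assert (H2 : 1 < s ^ 2) by (simpl; nra).
    rewrite (Rabs_left (1 - t ^ 2)) in * by lra.
    rewrite E, Rabs_mult, (Rabs_left (1 - s ^ 2)), (Rabs_left (s ^ 2 - t ^ 2)),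
      (Rabs_pos_eq (/ s ^ 2)) by lra.
    assert (/ s ^ 2 <= 1) by (apply Rmult_le_reg_l with (s ^ 2); lra).
    repeat split; try lra; try nra.
Qed.

(** By the mean value theorem the remainder is E times the integrand at some s times 1 - t. With D =
    |1 - t^2|, the factors are at most 2 * 4^b, D^a, (2D)^b and 1 in absolute value. *)
Lemma pade_remainder_bound (a b : nat) (t : R) : (a <= b)%nat ->
  0 < t -> t <> 1 -> Rabs (1 - t ^ 2) <= / 2 ->
  Rabs (padeP a b (t ^ 2) - t * padeQ a b (t ^ 2))
  <= 2 * 8 ^ b * Rabs (1 - t ^ 2) ^ (a + b).
Proof.
  intros Hab Ht Ht1 Hd.
  rewrite pade_remainder by lra.
  destruct (mvt_one (pade_prim a b (t ^ 2)) _ t Ht Ht1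
    (fun s => pade_prim_derive a b (t ^ 2) s)) as [s [-> Hs]].
  destruct (between_factors t s Ht Hd Hs) as [[H1 H1'] [H2 H2']].
  rewrite !Rabs_mult, <- !RPow_abs.
  pose proof (padeE_pos a b). rewrite (Rabs_pos_eq (padeE a b)) by lra.
  assert (H3 : Rabs (1 - t) <= 1).
  { pose proof (Rle_abs (- (1 - t ^ 2))) as Hd'. rewrite Rabs_Ropp in Hd'.
    apply Rabs_le. split; [|lra]. enough (t <= 2) by lra. simpl in *. nra. }
  assert (H4 : Rabs (1 - s ^ 2) ^ a <= Rabs (1 - t ^ 2) ^ a) by (apply pow_incr; lra).
  assert (H5 : Rabs (1 - t ^ 2 / s ^ 2) ^ b <= (2 * Rabs (1 - t ^ 2)) ^ b)
    by (apply pow_incr; lra).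
  apply Rle_trans with (2 * 4 ^ b
    * (Rabs (1 - t ^ 2) ^ a * (2 * Rabs (1 - t ^ 2)) ^ b * 1)).
  - assert (0 <= Rabs (1 - s ^ 2) ^ a) by (apply pow_le; lra).
    assert (0 <= Rabs (1 - t ^ 2 / s ^ 2) ^ b) by (apply pow_le; lra).
    pose proof (Rabs_pos (1 - t)).
    apply Rmult_le_compat; [lra| |now apply padeE_bound|].
    + repeat apply Rmult_le_pos; assumption.
    + repeat apply Rmult_le_compat; try assumption; try lra.
      now apply Rmult_le_pos.
  - right. rewrite Rpow_mult_distr, pow_add.
    replace 8 with (4 * 2) by ring. rewrite Rpow_mult_distr. ring.
Qed.

(* The mean value theorem, applied to the combination of the two primitives that
   vanishes if the approximants agree, would give [1 - s^2 >= 2/3] near [s = 1]. *)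
Lemma pade_independent (a b : nat) (t x : R) : (S a <= b)%nat ->
  0 < t -> t <> 1 -> Rabs (1 - t ^ 2) <= / 2 ->
  padeP a b (t ^ 2) = x * padeQ a b (t ^ 2) ->
  padeP (S a) b (t ^ 2) <> x * padeQ (S a) b (t ^ 2).
Proof.
  intros Hab Ht Ht1 Hd E1 E2.
  pose proof (pade_remainder a b t ltac:(lra)) as R1.
  pose proof (pade_remainder (S a) b t ltac:(lra)) as R2.
  rewrite E1 in R1. rewrite E2 in R2.
  assert (Hw : 0 < t ^ 2) by (apply pow_lt; lra).
  pose proof (padeQ_pos a b (t ^ 2) ltac:(lia) Hw) as Q1.
  pose proof (padeQ_S a b (t ^ 2) Hab Hw) as Q2.
  pose proof (padeE_pos a b) as P1.
  pose proof (padeE_pos (S a) b) as P2.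
  pose proof (padeE_S a b) as P3.
  set (q := padeQ a b (t ^ 2)) in *. set (q' := padeQ (S a) b (t ^ 2)) in *.
  set (e := padeE a b) in *. set (e' := padeE (S a) b) in *.
  (* With both approximants equal to x, this combination takes the same value at 1 and at t, so its
     derivative vanishes in between. *)
  destruct (mvt_one
    (minus_fct (mult_real_fct (e' * q) (pade_prim (S a) b (t ^ 2)))
       (mult_real_fct (e * q') (pade_prim a b (t ^ 2))))
    (fun s => (e' * q) * ((1 - s ^ 2) ^ S a * (1 - t ^ 2 / s ^ 2) ^ b)
       - (e * q') * ((1 - s ^ 2) ^ a * (1 - t ^ 2 / s ^ 2) ^ b)) t Ht Ht1)
    as [s [Hs1 Hs]].
  { intros s Hs. apply derivable_pt_lim_minus; apply derivable_pt_lim_scal;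
      now apply pade_prim_derive. }
  destruct (between_factors t s Ht Hd Hs) as [[H1 H1'] [H2 H2']].
  unfold minus_fct, mult_real_fct in Hs1.
  assert (Z : ((1 - s ^ 2) ^ a * (1 - t ^ 2 / s ^ 2) ^ b)
    * ((e' * q * (1 - s ^ 2) - e * q') * (1 - t)) = 0).
  { transitivity (q * (e' * (pade_prim (S a) b (t ^ 2) 1 - pade_prim (S a) b (t ^ 2) t))
      - q' * (e * (pade_prim a b (t ^ 2) 1 - pade_prim a b (t ^ 2) t))).
    - match type of Hs1 with ?l = _ => transitivity l; [|ring] end.
      rewrite Hs1. simpl. ring.
    - rewrite <- R1, <- R2. ring. }
  assert (N1 : 1 - s ^ 2 <> 0) by (intros N; rewrite N, Rabs_R0 in H1; lra).
  assert (N2 : 1 - t ^ 2 / s ^ 2 <> 0) by (intros N; rewrite N, Rabs_R0 in H2; lra).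
  apply Rmult_integral in Z. destruct Z as [Z|Z].
  - apply Rmult_integral in Z. destruct Z as [Z|Z]; revert Z; now apply pow_nonzero.
  - apply Rmult_integral in Z. destruct Z as [Z|Z]; [|lra].
    pose proof (Rle_abs (1 - s ^ 2)) as Hs3.
    (* By [Z], 1 - s^2 equals e q' / (e' q), which is at least 2/3 by [padeE_S] and [padeQ_S]. *)
    assert (L1 : e' * q <= 3 / 2 * (e * q')) by nra.
    assert (L2 : 0 < e * q') by nra.
    assert (L3 : 0 < e' * q) by nra.
    nra.
Qed.

(** With x = X/(R0 y^m), a multiplier c makes c (P - x Q) a nonzero integer, of absolute value at
    least 1. Since c |P - t Q| <= 1/2, it follows that c Q |t - x| >= 1/2, and Q <= 2 * 16^b
    concludes. The factor [R0] in the denominator serves the base beta. *)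
Lemma approx_lower_bound (U V y R0 X K t : R) (a b m : nat) :
  is_int U -> is_int V -> is_int y -> is_int R0 -> is_int X ->
  0 < V -> 1 <= y -> 1 <= R0 -> 1 <= K ->
  0 < t -> t <> 1 -> t ^ 2 = U / (V * y ^ 2) ->
  Rabs (1 - t ^ 2) <= / 2 -> Rabs (1 - t ^ 2) <= K / y ^ 2 ->
  (a <= b)%nat -> (m <= 2 * (b - a))%nat ->
  4 * R0 * (32 * K ^ 2 * V) ^ b <= y ^ (2 * a) ->
  padeP a b (t ^ 2) <> X / (R0 * y ^ m) * padeQ a b (t ^ 2) ->
  / (4 * R0 * (64 * V) ^ b * y ^ (2 * b)) <= Rabs (t - X / (R0 * y ^ m)).
Proof.
  intros HU HV Hy HR HX V0 y1 R1 K1 Ht Ht1 Hw Hd HdK Hab Hm Hbig Hne.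
  set (x := X / (R0 * y ^ m)) in *.
  set (P := padeP a b (t ^ 2)) in *. set (Q := padeQ a b (t ^ 2)) in *.
  set (c := 4 ^ b * V ^ b * y ^ (2 * b) * R0).
  assert (Hym : 0 < y ^ m) by (apply pow_lt; lra).
  assert (Hc : 0 < c).
  { unfold c. repeat apply Rmult_lt_0_compat; try apply pow_lt; lra. }
  assert (IP : is_int (4 ^ b * V ^ b * y ^ (2 * b) * P)).
  { unfold P. rewrite Hw. apply padeP_int; assumption || lra. }
  assert (IQ : is_int (4 ^ b * V ^ b * y ^ (2 * a) * Q)).
  { unfold Q. rewrite Hw. apply padeQ_int; assumption || lra. }
  assert (I : is_int (c * (P - x * Q))).
  (* As m <= 2(b - a), the power y^(2b) contains both y^m, which clears x, and the y^(2a) required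
     by Q. *)
  { replace (c * (P - x * Q)) with
      (R0 * (4 ^ b * V ^ b * y ^ (2 * b) * P)
       + (-1) * (X * (y ^ (2 * (b - a) - m) * (4 ^ b * V ^ b * y ^ (2 * a) * Q)))).
    - repeat (assumption || (apply is_int_pow; assumption) || apply is_int_IZR
              || apply is_int_plus || apply is_int_mult).
    - unfold c, x.
      replace (y ^ (2 * b)) with (y ^ m * y ^ (2 * (b - a) - m) * y ^ (2 * a))
        by (rewrite <- !pow_add; f_equal; lia).
      field. split; lra. }
  apply is_int_abs_ge1 in I;
    [|apply Rmult_integral_contrapositive_currified; [lra|]; intros N; apply Hne; lra].
  assert (B : c * Rabs (P - t * Q) <= / 2).
  { pose proof (pade_remainder_bound a b t Hab Ht Ht1 Hd) as HB.
    fold P Q in HB.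
    assert (HD : Rabs (1 - t ^ 2) ^ (a + b) <= (K / y ^ 2) ^ (a + b))
      by (apply pow_incr; split; [apply Rabs_pos|assumption]).
    assert (HK : K ^ (a + b) <= (K ^ 2) ^ b).
    { rewrite <- pow_mult. apply Rle_pow; [assumption|lia]. }
    assert (H8 : 0 < 8 ^ b) by (apply pow_lt; lra).
    assert (Hya : 0 < y ^ (2 * a)) by (apply pow_lt; lra).
    assert (Hyb : 0 < y ^ (2 * b)) by (apply pow_lt; lra).
    (* This bound equals 2 R0 (32 V)^b K^(a+b) / y^(2a); with K^(a+b) <= K^(2b), [Hbig] brings it
       below 1/2. *)
    apply Rle_trans with (c * (2 * 8 ^ b * (K / y ^ 2) ^ (a + b))).
    - apply Rmult_le_compat_l; [lra|]. eapply Rle_trans; [exact HB|].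
      apply Rmult_le_compat_l; [lra|assumption].
    - replace (c * (2 * 8 ^ b * (K / y ^ 2) ^ (a + b)))
        with (2 * R0 * (4 ^ b * 8 ^ b * V ^ b * K ^ (a + b)) / y ^ (2 * a)).
      + apply Rmult_le_reg_r with (y ^ (2 * a)); [assumption|].
        unfold Rdiv. rewrite Rmult_assoc, Rinv_l, Rmult_1_r by lra.
        apply Rle_trans with (/ 2 * (4 * R0 * (32 * K ^ 2 * V) ^ b)); [|lra].
        replace 32 with (4 * 8) by ring.
        rewrite (Rpow_mult_distr _ V), (Rpow_mult_distr _ (K ^ 2)), (Rpow_mult_distr 4 8).
        assert (0 < 4 ^ b * 8 ^ b * V ^ b)
          by (repeat apply Rmult_lt_0_compat; try apply pow_lt; lra).
        replace (/ 2 * (4 * R0 * (4 ^ b * 8 ^ b * (K ^ 2) ^ b * V ^ b)))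
          with (2 * R0 * (4 ^ b * 8 ^ b * V ^ b * (K ^ 2) ^ b)) by field.
        apply Rmult_le_compat_l; [lra|]. apply Rmult_le_compat_l; lra.
      + unfold Rdiv, c. rewrite Rpow_mult_distr, pow_inv, <- pow_mult.
        rewrite Nat.mul_add_distr_l, (pow_add y). field. split; lra. }
  assert (Qp : 0 < Q) by (apply padeQ_pos; [assumption|apply pow_lt; lra]).
  assert (Qb : Q <= 2 * 16 ^ b).
  { apply padeQ_bound; [assumption|apply pow_lt; lra|].
    pose proof (Rle_abs (- (1 - t ^ 2))) as Hd'. rewrite Rabs_Ropp in Hd'. lra. }
  assert (T : / 2 <= c * Q * Rabs (t - x)).
  { rewrite Rabs_mult, (Rabs_pos_eq c) in I by lra.
    pose proof (Rabs_triang (P - t * Q) ((t - x) * Q)) as T.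
    replace (P - t * Q + (t - x) * Q) with (P - x * Q) in T by ring.
    rewrite (Rabs_mult (t - x)), (Rabs_pos_eq Q) in T by lra.
    apply Rmult_le_compat_l with (r := c) in T; lra. }
  assert (D : 0 < 4 * R0 * (64 * V) ^ b * y ^ (2 * b)).
  { repeat apply Rmult_lt_0_compat; try apply pow_lt; lra. }
  apply Rmult_le_reg_l with (4 * R0 * (64 * V) ^ b * y ^ (2 * b)); [assumption|].
  rewrite Rinv_r by lra.
  replace (4 * R0 * (64 * V) ^ b * y ^ (2 * b)) with (2 * (c * (2 * 16 ^ b))).
  - assert (c * Q <= c * (2 * 16 ^ b)) by (apply Rmult_le_compat_l; lra).
    pose proof (Rabs_pos (t - x)).
    assert (c * Q * Rabs (t - x) <= c * (2 * 16 ^ b) * Rabs (t - x))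
      by (apply Rmult_le_compat_r; lra).
    lra.
  - unfold c. replace (64 * V) with (4 * 16 * V) by ring.
    rewrite !Rpow_mult_distr. ring.
Qed.

(** * Approximation by fractions with denominator a power *)

Lemma pow2_eventually (A : R) : exists M : nat, forall m, (M <= m)%nat -> A <= 2 ^ m.
Proof.
  destruct (Pow_x_infinity 2 ltac:(rewrite Rabs_pos_eq; lra) A) as [M HM].
  exists M. intros m Hm. specialize (HM m Hm).
  rewrite Rabs_pos_eq in HM; [lra|apply pow_le; lra].
Qed.

(** Descends from a large exponent to the first power that reaches T; minimality gives the upper
    bound. *)
Lemma pow_bracket (y T : R) : 2 <= y -> 1 <= T -> exists a : nat, T <= y ^ a <= y * T.
Proof.
  intros Hy HT.
  destruct (pow2_eventually T) as [n Hn]. specialize (Hn n (Nat.le_refl n)).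
  assert (H : T <= y ^ n) by (eapply Rle_trans; [exact Hn|apply pow_incr; lra]).
  clear Hn. induction n as [|n IH].
  - exists 0%nat. simpl in *. nra.
  - destruct (Rle_lt_dec T (y ^ n)) as [Hn|Hn]; [now apply IH|].
    exists (S n). split; [assumption|]. simpl. apply Rmult_le_compat_l; lra.
Qed.

(* The degree [a] is chosen so that [y^a] matches [4 R0 H^(1+m/2)]: this is just
   enough for the factor [y^(-2a)] gained in the remainder to beat the exponential
   size of the coefficients, while [y^(2a)] stays exponential in [m] with a base
   not depending on [y]. *)
Lemma restricted_approx (U V y R0 K t : R) :
  is_int U -> is_int V -> is_int y -> is_int R0 ->
  1 <= V -> 1 <= R0 -> 1 <= K -> 64 * K ^ 2 * V <= y ->
  0 < t -> t <> 1 -> t ^ 2 = U / (V * y ^ 2) ->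
  Rabs (1 - t ^ 2) <= K / y ^ 2 ->
  exists M : nat, forall m, (M <= m)%nat -> forall X, is_int X ->
    / (2 * (64 * K ^ 2 * V) ^ 2 * y) ^ m <= Rabs (t - X / (R0 * y ^ m)).
Proof.
  intros HU HV Hy HR V1 R1 K1 y1 Ht Ht1 Hw HdK.
  set (H := 64 * K ^ 2 * V) in *.
  assert (HK2 : 1 <= K ^ 2) by (apply pow_R1_Rle; assumption).
  assert (HKV : K ^ 2 <= K ^ 2 * V) by nra.
  assert (HH : 64 * V <= H) by (unfold H; nra).
  assert (HH1 : 64 <= H) by lra.
  assert (HH2 : 64 * K ^ 2 <= y) by (unfold H in *; lra).
  assert (Hd : Rabs (1 - t ^ 2) <= / 2).
  { eapply Rle_trans; [exact HdK|].
    assert (Hy2 : 0 < y ^ 2) by (apply pow_lt; lra).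
    apply Rmult_le_reg_r with (y ^ 2); [assumption|].
    unfold Rdiv. rewrite Rmult_assoc, Rinv_l, Rmult_1_r by lra.
    simpl in *. nra. }
  (* From [M] on, 2^m absorbs all factors independent of m; hence the 2 in the base of the bound. *)
  destruct (pow2_eventually (256 * R0 ^ 4 * H ^ 6 * y ^ 6)) as [M HM].
  exists M. intros m Hm X HX. specialize (HM m Hm).
  set (mu := ((m + 1) / 2)%nat).
  assert (Hmu : (m <= 2 * mu <= m + 1)%nat).
  { unfold mu. pose proof (Nat.div_mod (m + 1) 2 ltac:(lia)).
    pose proof (Nat.mod_upper_bound (m + 1) 2 ltac:(lia)). lia. }
  assert (HHmu : 1 <= H ^ S mu) by (apply pow_R1_Rle; lra).
  set (T := 4 * R0 * H ^ S mu).
  assert (HT : 1 <= T) by (unfold T; nra).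
  destruct (pow_bracket y T ltac:(lra) HT) as [a [Ha1 Ha2]].
  (* Here mu is m/2 rounded up. The extra 1 ensures m <= 2(b - a - 1), as the pair (a+1, b)
     requires. *)
  set (b := (a + S mu)%nat).
  assert (Hya : 1 <= y ^ a) by (apply pow_R1_Rle; lra).
  assert (Hbig : 4 * R0 * (32 * K ^ 2 * V) ^ b <= y ^ (2 * a)).
  { apply Rle_trans with (4 * R0 * H ^ b).
    - apply Rmult_le_compat_l; [lra|]. apply pow_incr. unfold H. nra.
    - unfold b. rewrite pow_add.
      replace (4 * R0 * (H ^ a * H ^ S mu)) with (T * H ^ a) by (unfold T; ring).
      replace (2 * a)%nat with (a + a)%nat by lia. rewrite pow_add.
      apply Rmult_le_compat; [lra|apply pow_le; lra|assumption|].
      apply pow_incr; lra. }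
  assert (HbigS : 4 * R0 * (32 * K ^ 2 * V) ^ b <= y ^ (2 * S a)).
  { eapply Rle_trans; [exact Hbig|]. apply Rle_pow; [lra|lia]. }
  assert (Hmain : / (4 * R0 * (64 * V) ^ b * y ^ (2 * b)) <= Rabs (t - X / (R0 * y ^ m))).
  { destruct (Req_dec (padeP a b (t ^ 2)) (X / (R0 * y ^ m) * padeQ a b (t ^ 2)))
      as [E|E].
    - apply (approx_lower_bound U V y R0 X K t (S a) b m);
        try assumption; try lra; try (unfold b; lia).
      apply pade_independent; try assumption. unfold b; lia.
    - apply (approx_lower_bound U V y R0 X K t a b m);
        try assumption; try lra; unfold b; lia. }
  eapply Rle_trans; [|exact Hmain].
  apply Rinv_le_contravar.
  { repeat apply Rmult_lt_0_compat; try apply pow_lt; lra. }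
  (* One y^a bounds (64 V)^a and two come from y^(2b); each is at most y T. The rest of y^(2b) is
     y^(2 mu + 2) <= y^(m+3). *)
  apply Rle_trans with (T ^ 4 * y ^ (m + 6)).
  - apply Rle_trans with (T * y ^ a * (y ^ a * y ^ a) * (y ^ (m + 3))).
    + unfold b. rewrite (pow_add (64 * V)).
      replace (2 * (a + S mu))%nat with (a + a + (2 * S mu))%nat by lia.
      rewrite (pow_add y (a + a)), (pow_add y a a).
      assert (L1 : (64 * V) ^ a <= y ^ a) by (apply pow_incr; lra).
      assert (L2 : (64 * V) ^ S mu <= H ^ S mu) by (apply pow_incr; lra).
      assert (L3 : y ^ (2 * S mu) <= y ^ (m + 3)) by (apply Rle_pow; [lra|lia]).
      assert (0 <= (64 * V) ^ a) by (apply pow_le; lra).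
      assert (0 <= (64 * V) ^ S mu) by (apply pow_le; lra).
      assert (0 <= y ^ (2 * S mu)) by (apply pow_le; lra).
      replace (4 * R0 * ((64 * V) ^ a * (64 * V) ^ S mu)
               * (y ^ a * y ^ a * y ^ (2 * S mu)))
        with (4 * R0 * (64 * V) ^ S mu * (64 * V) ^ a * (y ^ a * y ^ a)
              * y ^ (2 * S mu)) by ring.
      unfold T. clear -R1 Hya L1 L2 L3 H0 H1 H2.
      generalize dependent (y ^ a). generalize dependent ((64 * V) ^ a).
      generalize dependent ((64 * V) ^ S mu). generalize dependent (y ^ (2 * S mu)).
      generalize (H ^ S mu) (y ^ (m + 3)).
      intros. repeat apply Rmult_le_compat; try assumption; try lra;
        repeat apply Rmult_le_pos; assumption || lra.
    + assert (0 <= y ^ (m + 3)) by (apply pow_le; lra).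
      apply Rle_trans with (T * (y * T) * ((y * T) * (y * T)) * y ^ (m + 3)).
      * clearbody T. repeat apply Rmult_le_compat; try assumption; try lra;
          repeat apply Rmult_le_pos; assumption || lra.
      * right. rewrite !pow_add. ring.
  - replace (T ^ 4) with (256 * R0 ^ 4 * H ^ (4 + 4 * mu)).
    + apply Rle_trans with (256 * R0 ^ 4 * H ^ (6 + 2 * m) * y ^ (m + 6)).
      * apply Rmult_le_compat_r; [apply pow_le; lra|].
        apply Rmult_le_compat_l; [|apply Rle_pow; [lra|lia]].
        apply Rmult_le_pos; [lra|apply pow_le; lra].
      * rewrite !pow_add, !Rpow_mult_distr, (pow_mult H 2 m).
        replace (256 * R0 ^ 4 * (H ^ 6 * (H ^ 2) ^ m) * (y ^ m * y ^ 6))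
          with (256 * R0 ^ 4 * H ^ 6 * y ^ 6 * (H ^ 2) ^ m * y ^ m) by ring.
        apply Rmult_le_compat_r; [apply pow_le; lra|].
        apply Rmult_le_compat_r; [|assumption].
        apply pow_le, pow_le; lra.
    + unfold T. rewrite !Rpow_mult_distr, <- (pow_mult H).
      replace (S mu * 4)%nat with (4 + 4 * mu)%nat by lia. ring.
Qed.

(** Scaling by c and passing from y^m to y^(m+1) cost the fixed factor C y / c, which doubling the
    base absorbs for large m. Both changes occur when t is turned back into sqrt d. *)
Lemma restricted_approx_scaled (t R0 y C c : R) : 1 <= y -> 1 <= C -> 0 < c ->
  (exists M : nat, forall m, (M <= m)%nat -> forall X, is_int X ->
    / (C * y) ^ m <= Rabs (t - X / (R0 * y ^ m))) ->
  exists M : nat, forall m, (M <= m)%nat -> forall X, is_int X ->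
    / (2 * C * y) ^ m <= c * Rabs (t - X / (R0 * y ^ S m)).
Proof.
  intros Hy HC Hc [M HM].
  destruct (pow2_eventually (C * y / c)) as [M' HM'].
  exists (max M M'). intros m Hm X HX.
  specialize (HM (S m) ltac:(lia) X HX). specialize (HM' m ltac:(lia)).
  apply Rle_trans with (c * / (C * y) ^ S m); [|apply Rmult_le_compat_l; lra].
  assert (HCy : 1 <= C * y) by nra.
  assert (P1 : 0 < (C * y) ^ m) by (apply pow_lt; lra).
  assert (P2 : 0 < 2 ^ m) by (apply pow_lt; lra).
  rewrite (Rmult_assoc 2 C y), Rpow_mult_distr. simpl ((C * y) ^ S m).
  replace (c * / (C * y * (C * y) ^ m)) with (/ (C * y / c * (C * y) ^ m))
    by (field; repeat split; nra).
  apply Rinv_le_contravar.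
  - apply Rmult_lt_0_compat; [|assumption]. apply Rdiv_lt_0_compat; lra.
  - apply Rmult_le_compat_r; lra.
Qed.

(** * Convergents *)

Section Convergents.
Variable x : R.
Hypothesis x_irr : forall p q : Z, (0 < q)%Z -> x * IZR q <> IZR p.

(** For the complete quotient t = [cf_rem x (S k)], the formula x = (t p + p')/(t q + q') is
    preserved by t = a + 1/t'. *)
Lemma cf_invariant (k : nat) :
  let '(p, q, p', q') := cf_pq x k in
  (1 <= q)%Z /\ (0 <= q')%Z /\ (Z.abs (p * q' - p' * q) = 1)%Z
  /\ 1 < cf_rem x (S k)
  /\ x * (cf_rem x (S k) * IZR q + IZR q') = cf_rem x (S k) * IZR p + IZR p'.
Proof.
  assert (Hinv : forall u, 0 < u < 1 -> 1 < / u).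
  { intros u Hu. rewrite <- Rinv_1. apply Rinv_lt_contravar; lra. }
  induction k as [|k IH].
  - cbn [cf_pq cf_rem]. unfold cf_a, Rfloor. cbn [cf_rem].
    destruct (base_Int_part x) as [H1 H2].
    pose proof (x_irr (Int_part x) 1 ltac:(lia)) as H3.
    assert (Hu : 0 < x - IZR (Int_part x) < 1) by lra.
    repeat split; try lia.
    + now apply Hinv.
    + field. lra.
  - cbn [cf_pq]. destruct (cf_pq x k) as [[[p q] p'] q'].
    destruct IH as (Hq & Hq' & Hdet & Ht & Hx).
    change (cf_rem x (S (S k))) with
      (/ (cf_rem x (S k) - IZR (Rfloor (cf_rem x (S k))))).
    unfold cf_a. set (t := cf_rem x (S k)) in *. set (a := Rfloor t).
    destruct (base_Int_part t) as [H1 H2]. fold (Rfloor t) in H1, H2. fold a in H1, H2.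
    assert (Ha : (1 <= a)%Z).
    { assert (0 < a)%Z; [|lia]. apply lt_IZR. lra. }
    (* An integer t would make x the rational (a p + p')/(a q + q'). *)
    assert (Hta : t <> IZR a).
    { intros E. apply (x_irr (a * p + p') (a * q + q')); [nia|].
      rewrite !plus_IZR, !mult_IZR, <- E. exact Hx. }
    assert (Hu : 0 < t - IZR a < 1) by lra.
    repeat split; try nia.
    + now apply Hinv.
    + rewrite !plus_IZR, !mult_IZR.
      apply Rmult_eq_reg_r with (t - IZR a); [|lra].
      transitivity (x * (t * IZR q + IZR q')); [field; lra|].
      rewrite Hx. field. lra.
Qed.

(** The complete quotient formula and the determinant give |x q - p| (t q + q') = 1, and t q + q' >=
    q. *)
Lemma convergent_error (p q : Z) : is_convergent x p q ->
  Rabs (x * IZR q - IZR p) * IZR q <= 1.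
Proof.
  intros [k [Hp Hq]]. pose proof (cf_invariant k) as H.
  unfold cf_p, cf_q in *. destruct (cf_pq x k) as [[[p0 q0] p'] q']. subst p0 q0.
  destruct H as (H1 & H2 & Hdet & Ht & Hx). set (t := cf_rem x (S k)) in *.
  apply IZR_le in H1, H2. apply (f_equal IZR) in Hdet.
  rewrite abs_IZR, minus_IZR, !mult_IZR in Hdet.
  assert (HD : IZR q <= t * IZR q + IZR q') by nra.
  apply Rle_trans with (Rabs (x * IZR q - IZR p) * (t * IZR q + IZR q')).
  - apply Rmult_le_compat_l; [apply Rabs_pos|assumption].
  - rewrite <- (Rabs_pos_eq (t * IZR q + IZR q')) by lra.
    rewrite <- Rabs_mult.
    replace ((x * IZR q - IZR p) * (t * IZR q + IZR q'))
      with (IZR q * (x * (t * IZR q + IZR q')) - IZR p * (t * IZR q + IZR q')) by ring.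
    rewrite Hx.
    replace (IZR q * (t * IZR p + IZR p') - IZR p * (t * IZR q + IZR q'))
      with (- (IZR p * IZR q' - IZR p' * IZR q)) by ring.
    rewrite Rabs_Ropp, Hdet. lra.
Qed.

(** With e = x q - p the norm is e (e - 2 x q), where |e| q <= 1 and |e| <= 1. *)
Lemma convergent_norm_bound (p q : Z) : 0 < x -> (0 < q)%Z -> is_convergent x p q ->
  Rabs (IZR p ^ 2 - x ^ 2 * IZR q ^ 2) <= 2 * x + 1.
Proof.
  intros Hx Hq Hc. pose proof (convergent_error p q Hc) as He.
  assert (Hq1 : 1 <= IZR q) by (apply IZR_le; lia).
  replace (IZR p ^ 2 - x ^ 2 * IZR q ^ 2)
    with ((x * IZR q - IZR p) * ((x * IZR q - IZR p) - 2 * x * IZR q)) by ring.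
  set (e := x * IZR q - IZR p) in *.
  rewrite Rabs_mult.
  pose proof (Rabs_triang e (- (2 * x * IZR q))) as T.
  rewrite Rabs_Ropp, (Rabs_pos_eq (2 * x * IZR q)) in T by nra.
  fold (Rminus e (2 * x * IZR q)) in T.
  pose proof (Rabs_pos e). set (f := Rabs e) in *.
  assert (f <= 1) by nra.
  apply Rle_trans with (f * (f + 2 * x * IZR q)).
  - apply Rmult_le_compat_l; assumption.
  - nra.
Qed.

End Convergents.

(** * Application to the square root of d, for the bases alpha and beta *)

Theorem theorem4 (d : Q) (hd : 0 < Q2R d)
  (hirr : ~ exists r : Q, sqrt (Q2R d) = Q2R r) :
  exists (eta kappa : R) (N : Z), 0 < eta /\ 0 < kappa /\
    forall alpha beta : Z,
      (0 < alpha)%Z -> (0 < beta)%Z -> Z.gcd alpha beta = 1%Z ->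
      is_convergent (sqrt (Q2R d)) alpha beta ->
      (N <= alpha)%Z -> (N <= beta)%Z ->
      exists M : nat, forall m : nat, (M <= m)%nat -> forall n : Z,
        Rabs (sqrt (Q2R d) - IZR n / IZR alpha ^ m) >= / (eta * IZR alpha) ^ m /\
        Rabs (sqrt (Q2R d) - IZR n / IZR beta ^ m) >= / (kappa * IZR beta) ^ m.
Proof.
  set (x := sqrt (Q2R d)) in *.
  assert (Hx : 0 < x) by (apply sqrt_lt_R0; assumption).
  assert (Hx2 : x ^ 2 = Q2R d) by (apply pow2_sqrt; lra).
  assert (Hirr : forall p q : Z, (0 < q)%Z -> x * IZR q <> IZR p).
  { intros p q Hq E. apply hirr. exists (p # Z.to_pos q).
    unfold Q2R. cbn [Qnum Qden]. rewrite Z2Pos.id by assumption.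
    apply IZR_lt in Hq. rewrite <- E. field. lra. }
  destruct d as [r s]. unfold Q2R in *. cbn [Qnum Qden] in *.
  assert (Hs : 1 <= IZR (Z.pos s)) by (apply IZR_le; lia).
  assert (His : 0 < / IZR (Z.pos s)) by (apply Rinv_0_lt_compat; lra).
  assert (Hr : 1 <= IZR r).
  { apply IZR_le. assert (0 < r)%Z; [|lia]. apply lt_IZR. nra. }
  set (S0 := IZR (Z.pos s)) in *. set (R0 := IZR r) in *.
  assert (Hx2pos : 0 < x ^ 2) by (apply pow_lt; assumption).
  (* The second summand serves the base alpha, the third the base beta, and the 1 ensures K >= 1. *)
  set (K := 1 + (2 * x + 1) + (2 * x + 1) / x ^ 2).
  assert (HKx : 0 < (2 * x + 1) / x ^ 2) by (apply Rdiv_lt_0_compat; lra).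
  assert (HK : 1 <= K) by (unfold K; lra).
  assert (HK2 : 1 <= K ^ 2) by (apply pow_R1_Rle; assumption).
  assert (HCs : 1 <= 2 * (64 * K ^ 2 * S0) ^ 2).
  { assert (1 <= (64 * K ^ 2 * S0) ^ 2) by (apply pow_R1_Rle; nra). lra. }
  assert (HCr : 1 <= 2 * (64 * K ^ 2 * R0) ^ 2).
  { assert (1 <= (64 * K ^ 2 * R0) ^ 2) by (apply pow_R1_Rle; nra). lra. }
  (* The inner constants come from [restricted_approx], with V = S0 for alpha and V = R0 for beta,
     the outer 2 from the rescaling. The threshold gives 64 K^2 V <= y for both. *)
  exists (2 * (2 * (64 * K ^ 2 * S0) ^ 2)), (2 * (2 * (64 * K ^ 2 * R0) ^ 2)),
    (up (64 * K ^ 2 * (R0 + S0))).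
  split; [lra|]. split; [lra|].
  intros alpha beta Ha0 Hb0 _ Hconv Ha Hb.
  pose proof (convergent_norm_bound x Hirr alpha beta Hx Hb0 Hconv) as Hn.
  pose proof (Hirr alpha beta Hb0) as Hne.
  destruct (archimed (64 * K ^ 2 * (R0 + S0))) as [Hup _].
  apply IZR_le in Ha, Hb.
  assert (Ia : is_int (IZR alpha)) by apply is_int_IZR.
  assert (Ib : is_int (IZR beta)) by apply is_int_IZR.
  assert (Is : is_int S0) by apply is_int_IZR.
  assert (Ir : is_int R0) by apply is_int_IZR.
  assert (Ha1 : 1 <= IZR alpha) by (apply IZR_le; lia).
  assert (Hb1 : 1 <= IZR beta) by (apply IZR_le; lia).
  set (A := IZR alpha) in *. set (B := IZR beta) in *.
  assert (HA2 : 0 < A ^ 2) by (apply pow_lt; lra).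
  assert (HB2 : 0 < B ^ 2) by (apply pow_lt; lra).
  (* Here t = x B / A, so t^2 = R0 B^2 / (S0 A^2), and A / B times t is x. *)
  assert (Happ1 : exists M : nat, forall m, (M <= m)%nat -> forall X, is_int X ->
    / (2 * (2 * (64 * K ^ 2 * S0) ^ 2) * A) ^ m
    <= A / B * Rabs (x * B / A - X / (1 * A ^ S m))).
  { apply restricted_approx_scaled; try assumption; [apply Rdiv_lt_0_compat; lra|].
    apply restricted_approx with (U := R0 * B ^ 2); try assumption; try lra.
    - apply is_int_mult; [assumption|now apply is_int_pow].
    - apply is_int_IZR.
    - nra.
    - apply Rdiv_lt_0_compat; nra.
    - intros E. apply Hne. apply Rmult_eq_reg_r with (/ A);
        [|apply Rinv_neq_0_compat; lra]. rewrite Rinv_r by lra. exact E.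
    - transitivity (x ^ 2 * B ^ 2 / A ^ 2); [field; lra|]. rewrite Hx2. field. lra.
    - replace (1 - (x * B / A) ^ 2) with ((A ^ 2 - x ^ 2 * B ^ 2) / A ^ 2) by (field; lra).
      unfold Rdiv. rewrite Rabs_mult, Rabs_inv, (Rabs_pos_eq (A ^ 2)) by lra.
      apply Rmult_le_compat_r; [left; now apply Rinv_0_lt_compat|]. unfold K. lra. }
  (* Here t = A / (x B), so t^2 = S0 A^2 / (R0 B^2), and x^2 B / A times t is x. *)
  assert (Happ2 : exists M : nat, forall m, (M <= m)%nat -> forall X, is_int X ->
    / (2 * (2 * (64 * K ^ 2 * R0) ^ 2) * B) ^ m
    <= x ^ 2 * B / A * Rabs (A / (x * B) - X / (R0 * B ^ S m))).
  { apply restricted_approx_scaled; try assumption; [apply Rdiv_lt_0_compat; nra|].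
    apply restricted_approx with (U := S0 * A ^ 2); try assumption; try lra.
    - apply is_int_mult; [assumption|now apply is_int_pow].
    - nra.
    - apply Rdiv_lt_0_compat; nra.
    - intros E. apply Hne. apply Rmult_eq_reg_r with (/ (x * B));
        [|apply Rinv_neq_0_compat; nra]. rewrite Rinv_r by nra. symmetry. exact E.
    - transitivity (A ^ 2 / (x ^ 2 * B ^ 2)); [field; lra|]. rewrite Hx2. field. lra.
    - replace (1 - (A / (x * B)) ^ 2)
        with (- (A ^ 2 - x ^ 2 * B ^ 2) / (x ^ 2 * B ^ 2)) by (field; lra).
      unfold Rdiv. rewrite Rabs_mult, Rabs_inv, Rabs_Ropp, (Rabs_pos_eq (x ^ 2 * B ^ 2))
        by nra.
      rewrite Rinv_mult, <- Rmult_assoc.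
      apply Rmult_le_compat_r; [left; now apply Rinv_0_lt_compat|].
      apply Rle_trans with ((2 * x + 1) / x ^ 2); [|unfold K; lra].
      apply Rmult_le_compat_r; [left; now apply Rinv_0_lt_compat|assumption]. }
  destruct Happ1 as [M1 H1]. destruct Happ2 as [M2 H2].
  exists (max M1 M2). intros m Hm n. split; apply Rle_ge.
  - specialize (H1 m ltac:(lia) (IZR n * B)
      ltac:(apply is_int_mult; [apply is_int_IZR|assumption])).
    assert (0 < A ^ m) by (apply pow_lt; lra).
    rewrite <- (Rabs_pos_eq (A / B)) in H1
      by (left; apply Rdiv_lt_0_compat; lra).
    rewrite <- Rabs_mult in H1.
    replace (x - IZR n / A ^ m)
      with (A / B * (x * B / A - IZR n * B / (1 * A ^ S m))); [exact H1|].
    simpl. field. lra.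
  (* Since x^2 = R0 / S0, the fraction n A S0 / (R0 B^(m+1)) times x^2 B / A is n / B^m. *)
  - specialize (H2 m ltac:(lia) (IZR n * A * S0)
      ltac:(repeat (assumption || apply is_int_IZR || apply is_int_mult))).
    assert (0 < B ^ m) by (apply pow_lt; lra).
    rewrite <- (Rabs_pos_eq (x ^ 2 * B / A)) in H2
      by (left; apply Rdiv_lt_0_compat; nra).
    rewrite <- Rabs_mult in H2.
    replace (x - IZR n / B ^ m)
      with (x ^ 2 * B / A * (A / (x * B) - IZR n * A * S0 / (R0 * B ^ S m))); [exact H2|].
    rewrite Rmult_minus_distr_l.
    replace (x ^ 2 * B / A * (IZR n * A * S0 / (R0 * B ^ S m))) with (IZR n / B ^ m).
    + field. lra.
    + rewrite Hx2. simpl. field. lra.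
Qed.
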